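(* Let $n$ be a nonnegative integer and let $0 < q < p \leq \infty$. Then for all $f \in \mathcal{P}_{n,0}$, $$\|f\|_p \leq \left( \frac{qn+1}{2} \right)^{1/q-1/p} \|f\|_q .$$ Equality holds only for $f(x) = c(x+1)^n$ or $f(x) = c(x-1)^n$ with a real constant $c \neq 0$.
   Context: $\mathcal{P}_{n,0}$ denotes the set of all polynomials of degree at most $n$ with real coefficients having all their zeros outside the open unit disk, i.e. having no complex zero $z$ with $|z| < 1$ (in particular the identically zero polynomial is not in $\mathcal{P}_{n,0}$). For $0 < p < \infty$, $\|f\|_p := \left( \int_{-1}^1 |f(x)|^p \, dx \right)^{1/p}$, and $\|f\|_{\infty} := \max_{x \in [-1,1]} |f(x)|$. When $p = \infty$, $1/p$ is interpreted as $0$. *)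

(* Defs.v *)
From HB Require Import structures.
From mathcomp Require Import all_boot all_order all_algebra.
From mathcomp Require Import all_classical all_reals all_analysis.
From mathcomp Require Import complex.

Set Implicit Arguments.
Unset Strict Implicit.
Unset Printing Implicit Defensive.

Import Order.TTheory GRing.Theory Num.Theory.
Import numFieldNormedType.Exports.

Local Open Scope classical_set_scope.
Local Open Scope ring_scope.

(* The root condition ranges over the complex plane, so it excludes f = 0,
   of which every complex number is a root. *)
Definition poly_zero_free_disk (R : realType) (n : nat) : set {poly R} :=
  [set f : {poly R} | (size f <= n.+1)%N /\
    forall z : R[i], `|z| < 1 -> ~~ root (map_poly (real_complex R) f) z].

(* The L^p (quasi-)norm on [-1, 1] for 0 < p <= +oo; the value at -oo is
   irrelevant. For continuous f the supremum is attained (supnormE below). *)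
Definition pnorm (R : realType) (p : \bar R) (f : R -> R) : R :=
  match p with
  | r%:E => (\int[lebesgue_measure]_(x in `[-1, 1]) (`|f x| `^ r)) `^ (r^-1)
  | +oo%E => sup [set `|f x| | x in `[-1, 1]]
  | -oo%E => 0
  end.

(* 1/p as a real number, with 1/+oo = 0. *)
Definition expinv (R : realType) (p : \bar R) : R := fine (p^-1)%E.

Lemma expinv_fin (R : realType) (r : R) : r != 0 -> expinv r%:E = r^-1.
Proof. by move=> r0; rewrite /expinv inver (negbTE r0). Qed.

Lemma expinv_pinfty (R : realType) : expinv (+oo%E : \bar R) = 0.
Proof. by rewrite /expinv invey. Qed.

Lemma supnormE (R : realType) (f : R -> R) : {within `[-1, 1], continuous f} ->
  exists2 x, x \in `[(-1 : R), 1] & pnorm +oo%E f = `|f x| /\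
    forall y, y \in `[(-1 : R), 1] -> `|f y| <= `|f x|.
Proof.
move=> cf.
have le11 : (-1 : R) <= 1 by exact: le_trans (lerN10 R) ler01.
have cn : {within `[-1, 1], continuous (fun x => `|f x|)}.
  by move=> x; apply: (@cvg_comp _ _ _ f Num.norm _ _ _ (cf x)); exact: norm_continuous.
have [c c11 cmax] := EVT_max le11 cn.
exists c => //; split=> //=.
apply/eqP; rewrite eq_le; apply/andP; split.
- apply: ge_sup; first by exists `|f c|, c.
  by move=> _ [y y11 <-]; exact: cmax.
- apply: ub_le_sup; last by exists c.
  by exists `|f c| => _ [y y11 <-]; exact: cmax.
Qed.

(* Main.v *)
(* Let y be a point of [-1, 1] where |f| is maximal, with maximum M. Since all the
   zeros z satisfy |z| >= 1, each factor obeys |x - z| / |y - z| >= (1 + x) / (1 + y)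
   for x <= y, and symmetrically with 1 - x and 1 - y for x >= y; the product of
   at most n such factors gives |f x| >= M ((1 + x) / (1 + y))^n on [-1, y] and
   |f x| >= M ((1 - x) / (1 - y))^n on [y, 1]. Integrating the q-th powers yields
   M^q <= (q n + 1) / 2 * \int |f|^q, which is the case p = +oo, and the case of a
   finite p follows from |f|^p <= M^(p - q) |f|^q. Equality forces the pointwise
   bound to be an equality on an interval, hence |f| to be a multiple of
   |1 + x|^n or |1 - x|^n there. *)
Require Import Defs.
From HB Require Import structures.
From mathcomp Require Import all_boot all_order all_algebra.
From mathcomp Require Import all_classical all_reals all_analysis.
From mathcomp Require Import complex.
From mathcomp Require Import ring lra.

Import Order.TTheory GRing.Theory Num.Theory.
Import numFieldNormedType.Exports.

Local Open Scope classical_set_scope.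
Local Open Scope ring_scope.

(** * Distances from real points to a zero outside the open unit disk *)

(** With [z = a + i b], this is the squared form of [|y - z| (1 + x) <= |x - z| (1 + y)]. The
    difference of the two sides has the factor [y - x], and the cofactor is handled by the position
    of [a] relative to [-1]. *)
Lemma sqr_dist_ratio_le (R : realFieldType) (x y a b : R) :
  -1 <= x -> x <= y -> y <= 1 -> 1 <= a ^+ 2 + b ^+ 2 ->
  ((y - a) ^+ 2 + b ^+ 2) * (1 + x) ^+ 2 <= ((x - a) ^+ 2 + b ^+ 2) * (1 + y) ^+ 2.
Proof.
move=> x_ge xy y_le N1; rewrite -subr_ge0.
have -> : ((x - a) ^+ 2 + b ^+ 2) * (1 + y) ^+ 2 -
    ((y - a) ^+ 2 + b ^+ 2) * (1 + x) ^+ 2 =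
  (y - x) * ((a ^+ 2 + b ^+ 2 - 1) * (2 + x + y) + 2 * (a + 1) * (1 - x * y)).
  by ring.
apply: mulr_ge0; first by rewrite subr_ge0.
have [a_ge|a_lt] := leP (- 1) a.
  by apply: addr_ge0; [|apply: mulr_ge0]; nra.
(* Here the second summand is nonpositive. Dropping [b ^+ 2] leaves a multiple of [a + 1], whose
   sign is known. *)
apply: (@le_trans _ _ ((a ^+ 2 - 1) * (2 + x + y) + 2 * (a + 1) * (1 - x * y))).
  have -> : (a ^+ 2 - 1) * (2 + x + y) + 2 * (a + 1) * (1 - x * y) =
    (- (a + 1)) * ((- 1 - a) * (2 + x + y) + 2 * ((1 + x) * (1 + y))) by ring.
  by apply: mulr_ge0; [lra|apply: addr_ge0; apply: mulr_ge0; try apply: mulr_ge0; lra].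
rewrite lerD2r ler_wpM2r//; first lra.
by rewrite lerD2r lerDl sqr_ge0.
Qed.

(* The Moebius map [z |-> (x - z) / (y - z)] sends the exterior of the unit disk
   onto a disk whose point nearest to 0 is the image of [z = - s]. *)
Lemma dist_ratio_le (R : realType) (s x y : R) (z : R[i]) :
  s ^+ 2 = 1 -> -1 <= y <= 1 -> 0 <= 1 + s * x <= 1 + s * y -> 1 <= `|z| ->
  `|real_complex R y - z| * real_complex R (1 + s * x) <=
  `|real_complex R x - z| * real_complex R (1 + s * y).
Proof.
move=> s2 /andP[y_ge y_le] /andP[ux uxy].
have uy := le_trans ux uxy.
rewrite -(@expr_ge1 _ 2)// => N1.
rewrite -(@ler_pXn2r _ 2) ?nnegrE ?mulr_ge0 ?normr_ge0 ?lecR//.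
move: N1; rewrite !exprMn -!add_Re2_Im2.
case: z => a b /=; rewrite -!rmorphXn/= -!rmorphM/= !lecR sub0r sqrrN => N1.
have /eqP := s2; rewrite sqrf_eq1 => /orP[]/eqP s1; subst s.
  by rewrite !mul1r; apply: sqr_dist_ratio_le; lra.
have := @sqr_dist_ratio_le _ (- x) (- y) (- a) b.
rewrite !mulN1r -!opprD !sqrrN; apply; lra.
Qed.

Lemma poly_ratio_le (R : realType) (n : nat) (f : {poly R}) (s x y : R) :
  poly_zero_free_disk n f ->
  s ^+ 2 = 1 -> -1 <= y <= 1 -> 0 <= 1 + s * x <= 1 + s * y ->
  `|f.[y]| * (1 + s * x) ^+ n <= `|f.[x]| * (1 + s * y) ^+ n.
Proof.
move=> [sz_f zf] s2 y11 uxy; have /andP[ux uxy'] := uxy.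
have normE t : real_complex R `|f.[t]| =
    `|(map_poly (real_complex R) f).[real_complex R t]|.
  by rewrite horner_map normc_def /= expr0n addr0 sqrtr_sqr.
set g := map_poly _ f in zf normE.
have [r gE] := closed_field_poly_normal g.
have g0 : g != 0 by apply/eqP => g0; have := zf 0; rewrite g0 root0 normr0 => /(_ ltr01).
have sr : (size r <= n)%N.
  have := size_map_poly (real_complex R) f; rewrite -/g gE size_scale ?lead_coef_eq0//.
  by rewrite size_prod_XsubC => szf; move: sz_f; rewrite -szf ltnS.
have r_ge1 z : z \in r -> 1 <= `|z|.
  move=> zr; rewrite real_leNgt ?real1 ?normr_real//; apply/negP => /zf/negP; apply.
  by rewrite gE rootZ ?lead_coef_eq0// root_prod_XsubC.
have gnorm t : `|g.[t]| = `|lead_coef g| * \prod_(z <- r) `|t - z|.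
  rewrite [in LHS]gE hornerZ normrM horner_prod normr_prod.
  by congr (_ * _); apply: eq_bigr => z _; rewrite hornerXsubC.
rewrite -lecR !rmorphM/= !normE !gnorm !rmorphXn/=.
rewrite -!mulrA ler_wpM2l//.
have prodE t c : (\prod_(z <- r) `|t - z|) * c ^+ size r =
    \prod_(z <- r) (`|t - z| * c) :> R[i].
  by rewrite big_split/= big_const_seq count_predT iter_mulr_1.
(* The degree may be below [n]: [size r] powers are matched with the roots, and the surplus ones are
   compared through [1 + s * x <= 1 + s * y]. *)
rewrite -(subnK sr) !exprD ![_ ^+ (n - _) * _]mulrC !mulrA.
apply: ler_pM; rewrite ?mulr_ge0 ?exprn_ge0 ?prodr_ge0 ?lecR//.
  rewrite !prodE [leLHS]big_seq [leRHS]big_seq; apply: ler_prod => z /r_ge1 z1.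
  by apply/andP; split; [apply: mulr_ge0 => //; rewrite lecR|exact: dist_ratio_le].
by rewrite lerXn2r ?nnegrE ?lecR// (le_trans ux).
Qed.

(** * Continuity and integration of real powers *)

Lemma continuous_norm_powR (R : realType) (r : R) (f : R -> R) :
  0 <= r -> continuous f -> continuous (fun x => `|f x| `^ r).
Proof.
rewrite le_eqVlt => /predU1P[<- cf|r0 cf] x.
  by under eq_fun do rewrite powRr0; exact: cvg_cst.
suff cp (y : R) : `|z| `^ r @[z --> y] --> `|y| `^ r.
  by apply: (@continuous_comp _ _ _ f (fun y : R => `|y| `^ r)); [exact: cf|exact: cp].
(* At 0 the power need not be differentiable; there [|z| < e^(1/r)] gives [|z|^r < e]. Elsewhere
   differentiability gives continuity. *)
have [->|y0] := eqVneq y 0.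
  apply/cvgrPdist_lt => e e0; near=> z.
  rewrite normr0 powR0 ?gt_eqF// sub0r normrN ger0_norm ?powR_ge0//.
  rewrite -[ltRHS](@powRr1 _ e) ?(ltW e0)// -(mulVf (lt0r_neq0 r0)) powRrM.
  rewrite gt0_ltr_powR ?nnegrE ?powR_ge0//.
  by near: z; exact: (@nbhs0_lt _ R^o _ (powR_gt0 _ e0)).
apply: (@cvg_comp _ _ _ (fun z : R => `|z|) (@powR R ^~ r) _ (nbhs `|y|)).
  exact: norm_continuous.
have /derivable1_diffP/differentiable_continuous// : derivable (@powR R ^~ r) `|y| 1.
by apply: derivable_powR; rewrite in_itv/= andbT normr_gt0.
Unshelve. all: end_near. Qed.

Lemma continuous_itv_integrable (R : realType) (a b : R) (f : R -> R) :
  continuous f -> (@lebesgue_measure R).-integrable `[a, b] (EFin \o f).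
Proof.
move=> cf; apply: continuous_compact_integrable; first exact: segment_compact.
exact: continuous_subspaceT.
Qed.

Lemma Rintegral_itv_split (R : realType) (a b c : R) (f : R -> R) :
  continuous f -> a <= b <= c ->
  \int[lebesgue_measure]_(x in `[a, c]) f x =
  \int[lebesgue_measure]_(x in `[a, b]) f x + \int[lebesgue_measure]_(x in `[b, c]) f x.
Proof.
move=> cf /andP[ab bc].
rewrite -[X in _ + X]Rintegral_itv_obnd_cbnd.
  rewrite -(@Rintegral_itvB _ _ (BLeft a))//; last exact: continuous_itv_integrable.
  by rewrite addrC subrK.
apply: (@integrableS _ _ _ lebesgue_measure `[b, c]%classic) => //.
  by apply: subset_itvr; rewrite bnd_simp.
exact: continuous_itv_integrable.
Qed.

(** The primitive [F] from [a] lies between 0 and the total integral 0, so it vanishes near [x], and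
    so does its derivative [f x]. *)
Lemma Rintegral_eq0_itv (R : realType) (a b : R) (f : R -> R) :
  continuous f -> (forall x, x \in `[a, b] -> 0 <= f x) ->
  \int[lebesgue_measure]_(x in `[a, b]) f x = 0 ->
  {in `]a, b[, forall x, f x = 0}.
Proof.
move=> cf f0 If0 x /[dup] xab; rewrite in_itv/= => /andP[ax xb].
pose F y := \int[lebesgue_measure]_(t in `[a, y]) f t.
have [||_ <-] := @continuous_FTC1 _ f (BLeft a) x b xb _ _ (cf x).
- exact: continuous_itv_integrable.
- by rewrite lte_fin.
have Fge0 y z : a <= y -> z <= b -> 0 <= \int[lebesgue_measure]_(t in `[y, z]) f t.
  move=> ay zb; apply: Rintegral_ge0 => t /=; rewrite in_itv/= => /andP[yt tz].
  by apply: f0; rewrite in_itv/= (le_trans ay)//= (le_trans tz).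
have F0 : \near x, F x = (fun=> 0) x.
  near=> y.
  have ay : a <= y by apply/ltW; near: y; exact: lt_nbhsr.
  have yb : y <= b by apply/ltW; near: y; exact: lt_nbhsl.
  apply/eqP; rewrite eq_le Fge0// andbT -If0 (@Rintegral_itv_split _ _ y) ?ay//.
  by rewrite lerDl Fge0.
by rewrite derive1E (near_eq_derive _ F0) derive_cst.
Unshelve. all: end_near. Qed.

Lemma Rintegral_norm_affine_powR (R : realType) (s r a b : R) :
  s ^+ 2 = 1 -> 0 <= r -> a <= b -> (forall x, x \in `]a, b[ -> 0 < 1 + s * x) ->
  \int[lebesgue_measure]_(x in `[a, b]) (`|1 + s * x| `^ r) =
  s * (`|1 + s * b| `^ (r + 1) - `|1 + s * a| `^ (r + 1)) / (r + 1).
Proof.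
move=> s2 r0; rewrite le_eqVlt => /predU1P[-> _|ab u_gt0].
  by rewrite set_itv1 Rintegral_set1 subrr mulr0 mul0r.
have r1 : 0 < r + 1 by rewrite ltr_wpDl.
(* Since [s ^+ 2 = 1], multiplying by [s] is dividing by [s]. The absolute value makes [F]
   continuous everywhere, in particular at an end point where [1 + s * x] vanishes. *)
pose F x : R := `|1 + s * x| `^ (r + 1) * (s / (r + 1)).
have cu : continuous (fun x : R => 1 + s * x).
  by move=> x; apply: cvgD; [exact: cvg_cst|apply: cvgM; [exact: cvg_cst|exact: cvg_id]].
have cF : continuous F.
  move=> x; apply: cvgM; last exact: cvg_cst.
  exact: (@continuous_norm_powR _ _ _ (ltW r1) cu).
have dF x : x \in `]a, b[ -> is_derive x 1 F (`|1 + s * x| `^ r).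
  move=> xab; have ux := u_gt0 _ xab.
  apply: (@near_eq_is_derive _ _ _ (fun x => (1 + s * x) `^ (r + 1) * (s / (r + 1)))).
    near=> y; rewrite /F ger0_norm//; apply/ltW; near: y.
    exact: (cu x _ (lt_nbhsr ux)).
  have du : is_derive x 1 (fun x : R => 1 + s * x) s.
    have := @is_deriveD R R R (fun=> 1) (s \*: id) x 1 _ _ (is_derive_cst _ _ _)
      (@is_deriveZ R R R id s x 1 _ (is_derive_id _ _)).
    by rewrite add0r /GRing.scale/= mulr1.
  have dp := @is_derive1_comp _ (@powR R ^~ (r + 1)) _ x _ _ (is_derive1_powR (r + 1) ux) du.
  have := @is_deriveM _ _ _ (cst (s / (r + 1))) x 1 _ _ dp (is_derive_cst _ _ _).
  rewrite scaler0 add0r /cst /= => dM; apply: (is_derive_eq dM).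
  rewrite addrK ger0_norm ?ltW// /GRing.scale/=.
  have := lt0r_neq0 r1; move: (_ `^ _) => w r1'.
  transitivity (s ^+ 2 * w); last by rewrite s2 mul1r.
  by field.
rewrite /Rintegral (@continuous_FTC2 _ _ F _ _ ab).
- by rewrite /F -EFinB/=; ring.
- by apply: continuous_subspaceT; exact: continuous_norm_powR.
- split.
  + by move=> x /dF[].
  + by apply: cvg_at_right_filter; exact: cF.
  + by apply: cvg_at_left_filter; exact: cF.
- by move=> x /dF[_]; rewrite derive1E.
Unshelve. all: end_near. Qed.

(** * Polynomials determined by their values on an interval *)

Lemma poly_eq_itv (R : realType) (a b : R) (f g : {poly R}) :
  a < b -> (forall x, x \in `]a, b[ -> f.[x] = g.[x]) -> f = g.
Proof.
move=> ab fg; apply/eqP; rewrite -subr_eq0; apply/negP => /negP h0.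
(* Distinct points, as many as wanted; the shift by 2 keeps them strictly below [b]. *)
pose t (i : nat) : R := a + (b - a) / i.+2%:R.
have t_itv i : t i \in `]a, b[.
  have i2 : (1 : R) < i.+2%:R by rewrite ltr1n.
  have i0 : (0 : R) < i.+2%:R by rewrite ltr0n.
  rewrite in_itv/= /t ltrDl divr_gt0 ?subr_gt0//= -ltrBrDl ltr_pdivrMr//.
  by rewrite ltr_pMr ?subr_gt0.
have := max_poly_roots h0 (rs := mkseq t (size (f - g))) _ _.
rewrite size_mkseq ltnn => H; suff : false by []; apply: H.
  by apply/allP => _ /mapP[i _ ->]; rewrite rootE !hornerE fg ?subrr.
rewrite map_inj_uniq ?iota_uniq// => i j /addrI /mulfI.
rewrite subr_eq0 gt_eqF// => /(_ isT) /invr_inj/eqP.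
by rewrite eqr_nat => /eqP[].
Qed.

(** The squares agree on the interval, hence as polynomials, and the polynomial ring is an integral
    domain. *)
Lemma poly_norm_eq_itv (R : realType) (a b : R) (f g : {poly R}) :
  a < b -> (forall x, x \in `]a, b[ -> `|f.[x]| = `|g.[x]|) -> f = g \/ f = - g.
Proof.
move=> ab fg; have /eqP : f ^+ 2 = g ^+ 2.
  apply: (poly_eq_itv _ _ _ _ _ ab) => x /fg fgx.
  by rewrite !horner_exp -[LHS]real_normK ?num_real// fgx real_normK ?num_real.
by rewrite eqf_sqr => /orP[]/eqP; [left|right].
Qed.

(** * Bounding a value of the polynomial by the integral of its [q]-th power *)

Lemma poly_zero_free_disk_horner0 (R : realType) (n : nat) (f : {poly R}) :
  poly_zero_free_disk n f -> f.[0] != 0.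
Proof.
move=> [_ /(_ 0)]; rewrite normr0 => /(_ ltr01).
by have := fmorph_root (real_complex R) f 0; rewrite rmorph0 => ->.
Qed.

(* [`[a, b]] is meant to be [`[-1, y]] for [s = 1] and [`[y, 1]] for [s = -1]. *)
Lemma Rintegral_poly_side (R : realType) (n : nat) (q s y a b : R) (f : {poly R}) :
  poly_zero_free_disk n f -> 0 < q -> s ^+ 2 = 1 -> -1 <= y <= 1 -> a <= b ->
  (forall x, x \in `[a, b] -> 0 <= 1 + s * x <= 1 + s * y) ->
  (forall x, x \in `]a, b[ -> 0 < 1 + s * x) ->
  s * (`|1 + s * b| `^ (q * n%:R + 1) - `|1 + s * a| `^ (q * n%:R + 1)) =
    (1 + s * y) `^ (q * n%:R + 1) ->
  let I := \int[lebesgue_measure]_(x in `[a, b]) (`|f.[x]| `^ q) in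
  `|f.[y]| `^ q * (1 + s * y) <= (q * n%:R + 1) * I /\
  (a < b -> `|f.[y]| `^ q * (1 + s * y) = (q * n%:R + 1) * I ->
   exists2 c : R, c != 0 & f = c *: (1 + s *: 'X) ^+ n).
Proof.
move=> f_in q0 s2 y11 ab uxy ux sE I.
set u := 1 + s * y in uxy sE *; set M : R := `|f.[y]|; set r := q * n%:R in sE *.
have r0 : 0 <= r by rewrite mulr_ge0// ltW.
have r1 : 0 < r + 1 by rewrite ltr_wpDl.
have M0 : 0 <= M by exact: normr_ge0.
have I0 : 0 <= I by apply: Rintegral_ge0 => x _; exact: powR_ge0.
have u0 : 0 <= u.
  by have [] // := andP (uxy a _); [rewrite in_itv/= lexx|exact: le_trans].
(* [u = 0] means that [y] is the end point [- s]; the interval then cannot have positive length. *)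
have [uE|u_neq0] := eqVneq u 0.
  rewrite uE mulr0; split=> [|lt_ab]; first exact: mulr_ge0 (ltW r1) I0.
  have m_ab : (a + b) / 2 \in `]a, b[ by rewrite in_itv/= !midf_lt.
  have := uxy _ (subset_itv_oo_cc m_ab).
  by rewrite uE => /andP[_]; rewrite leNgt ux.
have u_gt0 : 0 < u by rewrite lt_neqAle eq_sym u_neq0.
have powE (t : R) : 0 <= t -> (t ^+ n) `^ q = t `^ r.
  by move=> t0; rewrite -powR_mulrn// -powRrM mulrC.
pose F x := `|f.[x]| `^ q; pose G x := `|1 + s * x| `^ r.
have cF : continuous F by apply: continuous_norm_powR; [exact: ltW|exact: continuous_horner].
have cG : continuous G.
  apply: continuous_norm_powR => // x.
  by apply: cvgD; [exact: cvg_cst|apply: cvgM; [exact: cvg_cst|exact: cvg_id]].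
(* By [poly_ratio_le] raised to the power [q], [D] is nonnegative on [[a, b]]. Its integral is a
   positive multiple of the gap in the claimed inequality, so equality makes [D] vanish inside. *)
pose D x := u `^ r * F x - M `^ q * G x.
have cMF (k : R) (H : R -> R) : continuous H -> continuous (fun x : R => k * H x : R).
  by move=> cH x; apply: cvgM; [exact: cvg_cst|exact: cH].
have cD : continuous D by move=> x; apply: cvgB; apply: cMF.
have D0 x : x \in `[a, b] -> 0 <= D x.
  move=> /uxy /[dup] /andP[ux0 _] uxu; rewrite subr_ge0 /F /G (ger0_norm ux0).
  rewrite -!powE// -!powRM ?exprn_ge0//.
  rewrite ge0_ler_powR ?(ltW q0) ?nnegrE ?mulr_ge0 ?exprn_ge0//.
  by rewrite [leRHS]mulrC; apply: poly_ratio_le.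
have DE : \int[lebesgue_measure]_(x in `[a, b]) D x =
    u `^ r / (r + 1) * ((r + 1) * I - M `^ q * u).
  rewrite RintegralB//; [|exact: continuous_itv_integrable (cMF _ _ _)..].
  rewrite !RintegralZl//; [|exact: continuous_itv_integrable..].
  rewrite Rintegral_norm_affine_powR// sE powRD ?u_neq0 ?implybT// powRr1//.
  by rewrite -/I; field; rewrite gt_eqF.
have ur : 0 < u `^ r / (r + 1) by rewrite divr_gt0// powR_gt0.
split=> [|lt_ab IE].
  by rewrite -subr_ge0 -(pmulr_rge0 _ ur) -DE; exact: Rintegral_ge0.
have D_eq0 : {in `]a, b[, forall x, D x = 0}.
  by apply: Rintegral_eq0_itv => //; rewrite DE IE subrr mulr0.
have [c fE] : exists c, f = c *: (1 + s *: 'X) ^+ n.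
  have un0 : u ^+ n != 0 by rewrite expf_neq0.
  have [] := @poly_norm_eq_itv _ a b f ((M / u ^+ n) *: (1 + s *: 'X) ^+ n) lt_ab.
  - move=> x xab; have /eqP := D_eq0 x xab; rewrite subr_eq0 => /eqP.
    have ux0 := ltW (ux _ xab).
    rewrite /F /G (ger0_norm ux0) -!powE// -!powRM ?exprn_ge0//.
    move=> /powR_injective; rewrite !nnegrE ?mulr_ge0 ?exprn_ge0// => /(_ q0 isT isT) fM.
    rewrite !hornerE [RHS]ger0_norm ?mulr_ge0 ?invr_ge0 ?exprn_ge0//.
    by rewrite mulrAC -fM mulrAC divff ?mul1r.
  - by move=> fE; exists (M / u ^+ n).
  - by move=> fE; exists (- (M / u ^+ n)); rewrite scaleNr.
exists c => //; apply: contra_neq (poly_zero_free_disk_horner0 _ _ _ f_in) => c0.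
by rewrite fE c0 scale0r horner0.
Qed.

(** The bounds on [[-1, y]] and [[y, 1]] carry the weights [1 + y] and [1 - y], whose sum 2 does not
    depend on [y]. *)
Lemma poly_powR_le_Rintegral (R : realType) (n : nat) (q y : R) (f : {poly R}) :
  poly_zero_free_disk n f -> 0 < q -> -1 <= y <= 1 ->
  let I := \int[lebesgue_measure]_(x in `[-1, 1]) (`|f.[x]| `^ q) in
  `|f.[y]| `^ q <= (q * n%:R + 1) / 2 * I /\
  (`|f.[y]| `^ q = (q * n%:R + 1) / 2 * I ->
   exists c : R, c != 0 /\ (f = c *: ('X + 1) ^+ n \/ f = c *: ('X - 1) ^+ n)).
Proof.
move=> f_in q0 y11 I; have /andP[y_ge y_le] := y11.
have r1 : 0 < q * n%:R + 1 by rewrite ltr_wpDl// mulr_ge0// ltW.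
have cF : continuous (fun x => `|f.[x]| `^ q).
  by apply: continuous_norm_powR; [exact: ltW|exact: continuous_horner].
pose I1 := \int[lebesgue_measure]_(x in `[-1, y]) (`|f.[x]| `^ q).
pose I2 := \int[lebesgue_measure]_(x in `[y, 1]) (`|f.[x]| `^ q).
have IE : I = I1 + I2 by exact: Rintegral_itv_split.
have [Il eql] : `|f.[y]| `^ q * (1 + 1 * y) <= (q * n%:R + 1) * I1 /\
    (-1 < y -> `|f.[y]| `^ q * (1 + 1 * y) = (q * n%:R + 1) * I1 ->
     exists2 c : R, c != 0 & f = c *: (1 + 1 *: 'X) ^+ n).
  apply: Rintegral_poly_side => //.
  - by rewrite expr1n.
  - by move=> x; rewrite in_itv/= => /andP[]; lra.
  - by move=> x; rewrite in_itv/= => /andP[]; lra.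
  - rewrite !mul1r subrr normr0 powR0 ?gt_eqF// subr0 ger0_norm//; lra.
have [Ir eqr] : `|f.[y]| `^ q * (1 + (-1) * y) <= (q * n%:R + 1) * I2 /\
    (y < 1 -> `|f.[y]| `^ q * (1 + (-1) * y) = (q * n%:R + 1) * I2 ->
     exists2 c : R, c != 0 & f = c *: (1 + (-1) *: 'X) ^+ n).
  apply: Rintegral_poly_side => //.
  - by rewrite sqrrN expr1n.
  - by move=> x; rewrite in_itv/= => /andP[]; lra.
  - by move=> x; rewrite in_itv/= => /andP[]; lra.
  - rewrite mulr1 subrr normr0 powR0 ?gt_eqF// sub0r mulN1r opprK mulN1r.
    by rewrite ger0_norm//; lra.
move: (q * n%:R + 1) (`|f.[y]| `^ q) r1 Il eql Ir eqr => r K r1 Il eql Ir eqr.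
have IE' : r * I = r * I1 + r * I2 by rewrite IE mulrDr.
rewrite mulrAC; split; first by lra.
move=> KE.
(* Equality in the sum forces equality on each side, and one side has positive length: the left one
   unless [y = -1], and then the right one. *)
have [y_gt|] := ltP (-1) y.
  have [|c c0 ->] := eql y_gt; first by lra.
  by exists c; split=> //; left; rewrite scale1r addrC.
move=> y1; have [||c c0 ->] := eqr; [lra|lra|].
exists (c * (-1) ^+ n); split; first by rewrite mulf_neq0// signr_eq0.
by right; rewrite -scalerA -exprZn !scaleN1r opprB addrC.
Qed.

(** * From the maximum to the norm of exponent [p] *)

Theorem theorem2p2 (R : realType) (n : nat) (q : R) (p : \bar R)
    (q_gt0 : 0 < q) (lt_qp : (q%:E < p)%E)
    (f : {poly R}) (f_in : @poly_zero_free_disk R n f) :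
  pnorm p (horner f) <=
    ((q * n%:R + 1) / 2) `^ (q^-1 - expinv p) * pnorm q%:E (horner f)
  /\
  (pnorm p (horner f) =
    ((q * n%:R + 1) / 2) `^ (q^-1 - expinv p) * pnorm q%:E (horner f) ->
   exists c : R, c != 0 /\
     (f = c *: ('X + 1) ^+ n \/ f = c *: ('X - 1) ^+ n)).
Proof.
set C := (q * n%:R + 1) / 2; set I := \int[lebesgue_measure]_(x in `[-1, 1]) (`|f.[x]| `^ q).
have cf : continuous (horner f) by exact: continuous_horner.
have [y y11 [supE f_le]] := supnormE (continuous_subspaceT cf).
set M : R := `|f.[y]| in supE f_le.
have M_gt0 : 0 < M.
  apply: lt_le_trans (f_le 0 _); first by rewrite normr_gt0; exact: poly_zero_free_disk_horner0 f_in.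
  by rewrite in_itv/= lerN10 ler01.
move: y11; rewrite in_itv => y11.
have [leM eqM] := poly_powR_le_Rintegral _ n q y f f_in q_gt0 y11.
rewrite -/I -/M -/C in leM eqM.
have Mq_gt0 : 0 < M `^ q by rewrite powR_gt0.
have C_gt0 : 0 < C by rewrite divr_gt0// ltr_wpDl// mulr_ge0// ltW.
have I_gt0 : 0 < I by rewrite -(pmulr_rgt0 _ C_gt0); exact: lt_le_trans leM.
have CI_ge0 := ltW (mulr_gt0 C_gt0 I_gt0).
have q0 : q != 0 by rewrite gt_eqF.
case: p lt_qp => [p||]//=; last first.
  move=> _; have -> : sup [set `|f.[x]| | x in `[-1, 1]] = M := supE.
  rewrite expinv_pinfty subr0 -/I -powRM ?(ltW C_gt0) ?(ltW I_gt0)//.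
  split.
    have -> : M = (M `^ q) `^ q^-1 by rewrite -powRrM mulfV// powRr1// ltW.
    by rewrite ge0_ler_powR ?nnegrE ?invr_ge0 ?(ltW q_gt0) ?(ltW Mq_gt0).
  by move=> ME; apply: eqM; rewrite ME -powRrM mulVf// powRr1.
rewrite lte_fin => qp; have p_gt0 := lt_trans q_gt0 qp.
rewrite expinv_fin ?gt_eqF// -/I.
set J := \int[lebesgue_measure]_(x in `[-1, 1]) (`|f.[x]| `^ p).
(* This is [|f|^p <= M^(p - q) |f|^q] integrated, with [M^(p - q)] written as a power of [M^q] so
   that [leM] applies to it. *)
have JM : J <= (M `^ q) `^ (p / q - 1) * I.
  rewrite /I -RintegralZl//; last first.
    apply: continuous_itv_integrable.
    by apply: continuous_norm_powR => //; exact: ltW.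
  apply: le_Rintegral => //.
  - by apply: continuous_itv_integrable; apply: continuous_norm_powR => //; exact: ltW.
  - apply: continuous_itv_integrable => x; apply: cvgM; first exact: cvg_cst.
    by apply: continuous_norm_powR => //; exact: ltW.
  move=> x x11; have /f_le fxM : x \in `[-1, 1] by [].
  rewrite -powRrM (_ : q * (p / q - 1) = p - q); last by field.
  have [->|fx0] := eqVneq f.[x] 0.
    by rewrite normr0 powR0 ?gt_eqF// mulr_ge0// powR_ge0.
  have fx_gt0 : 0 < `|f.[x]| by rewrite normr_gt0.
  have -> : `|f.[x]| `^ p = `|f.[x]| `^ (p - q) * `|f.[x]| `^ q.
    by rewrite -powRD ?subrK// (gt_eqF fx_gt0) implybT.
  by rewrite ler_wpM2r ?powR_ge0// ge0_ler_powR ?nnegrE ?subr_ge0 ?(ltW qp) ?(ltW M_gt0).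
have J0 : 0 <= J by apply: Rintegral_ge0 => x _; exact: powR_ge0.
have pq1 : 0 < p / q - 1 by rewrite subr_gt0 ltr_pdivlMr// mul1r.
have MC : (M `^ q) `^ (p / q - 1) * I <= (C * I) `^ (p / q - 1) * I.
  by rewrite ler_wpM2r ?(ltW I_gt0)// ge0_ler_powR ?nnegrE ?(ltW pq1) ?(ltW Mq_gt0).
(* With the right-hand side as a [1/p]-th power, the claim reduces to comparing [J] with its
   base. *)
have -> : C `^ (q^-1 - p^-1) * I `^ q^-1 = ((C * I) `^ (p / q - 1) * I) `^ p^-1.
  have -> : (C * I) `^ (p / q - 1) * I = C `^ (p / q - 1) * I `^ (p / q).
    rewrite powRM ?(ltW C_gt0) ?(ltW I_gt0)// -mulrA; congr (_ * _).
    rewrite -[X in _ * X](powRr1 (ltW I_gt0)) -powRD ?subrK//.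
    by rewrite (gt_eqF I_gt0) implybT.
  rewrite powRM ?powR_ge0// -!powRrM.
  by congr (_ `^ _ * _ `^ _); field; rewrite ?q0 gt_eqF.
have p0 : 0 < p^-1 by rewrite invr_gt0.
have C0 : 0 <= (C * I) `^ (p / q - 1) * I by rewrite mulr_ge0 ?powR_ge0// ltW.
split.
  by rewrite ge0_ler_powR ?nnegrE ?(ltW p0)//; exact: le_trans MC.
(* Equality collapses the chain [JM], [MC]; cancelling [I] and the exponent [p / q - 1], both
   positive, leaves [M^q = C I], the equality case at the maximum point. *)
move=> /(powR_injective p0); rewrite !nnegrE => /(_ J0 C0) JE.
apply: eqM; have /mulIf : I != 0 by rewrite gt_eqF.
move=> /(_ ((M `^ q) `^ (p / q - 1)) ((C * I) `^ (p / q - 1))) inj.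
apply: (powR_injective pq1); rewrite ?nnegrE ?(ltW Mq_gt0)//; apply: inj.
by apply/eqP; rewrite eq_le MC -JE JM.
Qed.
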